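(* Let $\nu\ge 0$ and let $u_1(z,t)$, $\omega_1(z,t)$, $\psi_1(z,t)$ be a solution of the one-dimensional system $$(u_1)_t+2\psi_1 (u_1)_z=\nu (u_1)_{zz}+2(\psi_1)_z u_1,$$ $$(\omega_1)_t+2\psi_1(\omega_1)_z=\nu(\omega_1)_{zz}+(u_1^2)_z,$$ $$-(\psi_1)_{zz}=\omega_1 .$$ Define, for $r>0$, $$u(r,z,t)=r\,u_1(z,t),\qquad \omega(r,z,t)=r\,\omega_1(z,t),\qquad \psi(r,z,t)=r\,\psi_1(z,t).$$ Then $(u,\omega,\psi)$ is an exact solution of the 3D axisymmetric Navier-Stokes equations with swirl (in the angular velocity / angular vorticity / angular stream function formulation recalled in the context).
   Context: Subscripts $t,z,r$ denote partial derivatives, and $\nu$ is the viscosity. Solutions are understood in the classical sense. 3D axisymmetric Navier-Stokes equations with swirl: with $r=\sqrt{x^2+y^2}$ and $e_r,e_\theta,e_z$ the unit vectors in the radial, angular and $z$ directions, an axisymmetric velocity field is written $\vec u=v^r(r,z,t)e_r+u(r,z,t)e_\theta+v^z(r,z,t)e_z$. Here $u$ is the angular velocity, $\omega=v^r_z-v^z_r$ is the angular vorticity, and $\psi$ is the angular stream function. The 3D axisymmetric Navier-Stokes equations for $(u,\omega,\psi)$ are $$u_t+v^r u_r+v^z u_z=\nu\Big(\nabla^2-\frac1{r^2}\Big)u-\frac1r v^r u,$$ $$\omega_t+v^r\omega_r+v^z\omega_z=\nu\Big(\nabla^2-\frac1{r^2}\Big)\omega+\frac1r(u^2)_z+\frac1r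 v^r\omega,$$ $$-\Big(\nabla^2-\frac1{r^2}\Big)\psi=\omega,$$ where $$v^r=-\frac{\partial\psi}{\partial z},\qquad v^z=\frac1r\frac{\partial}{\partial r}(r\psi),\qquad \nabla^2=\partial_r^2+\frac1r\partial_r+\partial_z^2 .$$ *)

(* Defs.v *)
From Stdlib Require Export Reals.
From Coquelicot Require Export Coquelicot.

Open Scope R_scope.

Definition dz2 (f : R -> R -> R) (z t : R) : R := Derive (fun z' => f z' t) z.
Definition dt2 (f : R -> R -> R) (z t : R) : R := Derive (fun t' => f z t') t.

Definition cont2 (D : R * R -> Prop) (f : R -> R -> R) : Prop :=
  forall p, D p -> continuous (fun q : R * R => f (fst q) (snd q)) p.

(* [Derive] is total, so existence of each derivative is required separately. *)
Definition has_dz2 (D : R * R -> Prop) (f : R -> R -> R) : Prop :=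
  (forall z t, D (z, t) -> ex_derive (fun z' => f z' t) z) /\ cont2 D (dz2 f).

Definition has_dt2 (D : R * R -> Prop) (f : R -> R -> R) : Prop :=
  (forall z t, D (z, t) -> ex_derive (fun t' => f z t') t) /\ cont2 D (dt2 f).

Definition C1_zt (D : R * R -> Prop) (f : R -> R -> R) : Prop :=
  cont2 D f /\ has_dz2 D f /\ has_dt2 D f.

Definition C2_z (D : R * R -> Prop) (f : R -> R -> R) : Prop :=
  cont2 D f /\ has_dz2 D f /\ has_dz2 D (dz2 f).

(* The second derivatives of [u1] and [omega1] occur only through the viscous
   terms, so a classical solution has to possess them only when [0 < nu]. *)
Record classical_solution_1D (nu : R) (D : R * R -> Prop)
    (u1 omega1 psi1 : R -> R -> R) : Prop := {
  sol1_u_C1 : C1_zt D u1;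
  sol1_omega_C1 : C1_zt D omega1;
  sol1_u_C2 : 0 < nu -> C2_z D u1;
  sol1_omega_C2 : 0 < nu -> C2_z D omega1;
  sol1_psi_C2 : C2_z D psi1;
  sol1_u_eq : forall z t, D (z, t) ->
    dt2 u1 z t + 2 * psi1 z t * dz2 u1 z t
    = nu * dz2 (dz2 u1) z t + 2 * dz2 psi1 z t * u1 z t;
  sol1_omega_eq : forall z t, D (z, t) ->
    dt2 omega1 z t + 2 * psi1 z t * dz2 omega1 z t
    = nu * dz2 (dz2 omega1) z t + dz2 (fun z' t' => u1 z' t' ^ 2) z t;
  sol1_psi_eq : forall z t, D (z, t) -> - dz2 (dz2 psi1) z t = omega1 z t
}.

Definition dr3 (f : R -> R -> R -> R) (r z t : R) : R :=
  Derive (fun r' => f r' z t) r.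
Definition dz3 (f : R -> R -> R -> R) (r z t : R) : R :=
  Derive (fun z' => f r z' t) z.
Definition dt3 (f : R -> R -> R -> R) (r z t : R) : R :=
  Derive (fun t' => f r z t') t.

Definition cont3 (W : R * R * R -> Prop) (f : R -> R -> R -> R) : Prop :=
  forall p, W p ->
    continuous (fun q : R * R * R => f (fst (fst q)) (snd (fst q)) (snd q)) p.

Definition has_dr3 (W : R * R * R -> Prop) (f : R -> R -> R -> R) : Prop :=
  (forall r z t, W (r, z, t) -> ex_derive (fun r' => f r' z t) r)
  /\ cont3 W (dr3 f).

Definition has_dz3 (W : R * R * R -> Prop) (f : R -> R -> R -> R) : Prop :=
  (forall r z t, W (r, z, t) -> ex_derive (fun z' => f r z' t) z)
  /\ cont3 W (dz3 f).

Definition has_dt3 (W : R * R * R -> Prop) (f : R -> R -> R -> R) : Prop :=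
  (forall r z t, W (r, z, t) -> ex_derive (fun t' => f r z t') t)
  /\ cont3 W (dt3 f).

Definition C1_rz (W : R * R * R -> Prop) (f : R -> R -> R -> R) : Prop :=
  cont3 W f /\ has_dr3 W f /\ has_dz3 W f.

Definition C1_rzt (W : R * R * R -> Prop) (f : R -> R -> R -> R) : Prop :=
  C1_rz W f /\ has_dt3 W f.

Definition C2_rz (W : R * R * R -> Prop) (f : R -> R -> R -> R) : Prop :=
  C1_rz W f /\ C1_rz W (dr3 f) /\ C1_rz W (dz3 f).

Definition laplacian (f : R -> R -> R -> R) (r z t : R) : R :=
  dr3 (dr3 f) r z t + 1 / r * dr3 f r z t + dz3 (dz3 f) r z t.

Definition angular_laplacian (f : R -> R -> R -> R) (r z t : R) : R :=
  laplacian f r z t - 1 / r ^ 2 * f r z t.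

Definition v_r (psi : R -> R -> R -> R) (r z t : R) : R := - dz3 psi r z t.

Definition v_z (psi : R -> R -> R -> R) (r z t : R) : R :=
  1 / r * dr3 (fun r' z' t' => r' * psi r' z' t') r z t.

(* Meaningful for open [W] contained in {0 < r}.  As in one dimension, second
   derivatives of [u] and [omega] are required only when [0 < nu]. *)
Record classical_solution_axisym_NS (nu : R) (W : R * R * R -> Prop)
    (u omega psi : R -> R -> R -> R) : Prop := {
  ns_u_C1 : C1_rzt W u;
  ns_omega_C1 : C1_rzt W omega;
  ns_u_C2 : 0 < nu -> C2_rz W u;
  ns_omega_C2 : 0 < nu -> C2_rz W omega;
  ns_psi_C2 : C2_rz W psi;
  ns_u_eq : forall r z t, W (r, z, t) ->
    dt3 u r z t + v_r psi r z t * dr3 u r z t + v_z psi r z t * dz3 u r z t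
    = nu * angular_laplacian u r z t - 1 / r * v_r psi r z t * u r z t;
  ns_omega_eq : forall r z t, W (r, z, t) ->
    dt3 omega r z t + v_r psi r z t * dr3 omega r z t
      + v_z psi r z t * dz3 omega r z t
    = nu * angular_laplacian omega r z t
      + 1 / r * dz3 (fun r' z' t' => u r' z' t' ^ 2) r z t
      + 1 / r * v_r psi r z t * omega r z t;
  ns_psi_eq : forall r z t, W (r, z, t) ->
    - angular_laplacian psi r z t = omega r z t;
  ns_vorticity : forall r z t, W (r, z, t) ->
    omega r z t = dz3 (v_r psi) r z t - dr3 (v_z psi) r z t
}.

Definition off_axis (D : R * R -> Prop) (p : R * R * R) : Prop :=
  0 < fst (fst p) /\ D (snd (fst p), snd p).

(* Main.v *)
(** Fields of the form [r * f z t] are preserved by [dz3] and [dt3] and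
    annihilated by the radial part [dr3 (dr3 f) + dr3 f / r - f / r ^ 2] of the
    angular Laplacian.  Moreover [v_r] is [- r * dz2 psi1] and [v_z] is
    [2 * psi1], independent of [r], so each axisymmetric equation is [r] times
    its one-dimensional counterpart. *)

From Stdlib Require Import Lra FunctionalExtensionality.
Require Import Defs.

(** Stated as an equality of functions, so that it rewrites inside iterated derivatives such as
    [dr3 (dr3 f)]. *)
Lemma dr3_linear (f : R -> R -> R) :
  dr3 (fun r z t => r * f z t) = (fun _ z t => f z t).
Proof.
extensionality r; extensionality z; extensionality t.
unfold dr3.
rewrite Derive_scal_l, Derive_id.
ring.
Qed.

Lemma dz3_linear (f : R -> R -> R) :
  dz3 (fun r z t => r * f z t) = (fun r z t => r * dz2 f z t).
Proof.
extensionality r; extensionality z; extensionality t.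
apply Derive_scal.
Qed.

Lemma dt3_linear (f : R -> R -> R) :
  dt3 (fun r z t => r * f z t) = (fun r z t => r * dt2 f z t).
Proof.
extensionality r; extensionality z; extensionality t.
apply Derive_scal.
Qed.

Lemma dr3_radially_constant (f : R -> R -> R) :
  dr3 (fun _ z t => f z t) = (fun _ _ _ => 0).
Proof.
extensionality r; extensionality z; extensionality t.
exact (Derive_const (f z t) r).
Qed.

(** For the swirl source of the vorticity equation: its prefactor [1 / r] reduces [r ^ 2] to the
    common factor [r]. *)
Lemma dz3_linear_sqr (f : R -> R -> R) (r z t : R) :
  dz3 (fun r z t => (r * f z t) ^ 2) r z t
  = r ^ 2 * dz2 (fun z t => f z t ^ 2) z t.
Proof.
unfold dz3, dz2.
rewrite <- Derive_scal.
apply Derive_ext; intros z'; ring.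
Qed.

Lemma angular_laplacian_linear (f : R -> R -> R) (r z t : R) :
  0 < r ->
  angular_laplacian (fun r z t => r * f z t) r z t = r * dz2 (dz2 f) z t.
Proof.
intros r_gt0.
unfold angular_laplacian, laplacian.
rewrite !dz3_linear, dr3_linear, dr3_radially_constant.
field; lra.
Qed.

(** The sign stays inside, so that the right-hand side is again of the form [r * g z t] and
    [dz3_linear] applies to it. *)
Lemma v_r_linear (f : R -> R -> R) :
  v_r (fun r z t => r * f z t) = (fun r z t => r * - dz2 f z t).
Proof.
extensionality r; extensionality z; extensionality t.
unfold v_r.
rewrite dz3_linear.
ring.
Qed.

Lemma v_z_linear (f : R -> R -> R) (r z t : R) :
  0 < r -> v_z (fun r z t => r * f z t) r z t = 2 * f z t.
Proof.
intros r_gt0.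
unfold v_z, dr3.
(* The function differentiated is [r * (r * f z t)], quadratic in [r]. *)
rewrite (is_derive_unique _ r (2 * r * f z t)).
- field; lra.
- auto_derive; [easy | ring].
Qed.

(* The identity [v_z = 2 * f] fails at [r = 0], where [1 / 0 = 0], so it may be
   differentiated only locally. *)
Lemma dr3_v_z_linear (f : R -> R -> R) (r z t : R) :
  0 < r -> dr3 (v_z (fun r z t => r * f z t)) r z t = 0.
Proof.
intros r_gt0.
unfold dr3 at 1.
rewrite (Derive_ext_loc _ (fun _ => 2 * f z t)).
- apply Derive_const.
- apply (filter_imp (fun r' => 0 < r')).
  + intros r'; apply v_z_linear.
  + exact (open_gt 0 r r_gt0).
Qed.

Lemma dz3_v_r_linear (f : R -> R -> R) (r z t : R) :
  dz3 (v_r (fun r z t => r * f z t)) r z t = - (r * dz2 (dz2 f) z t).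
Proof.
rewrite v_r_linear, dz3_linear.
unfold dz2 at 1.
rewrite Derive_opp.
unfold dz2; ring.
Qed.

(** Composition with the continuous projection from [(r, z, t)] to [(z, t)], which maps [off_axis D]
    into [D]. *)
Lemma cont3_radially_constant (D : R * R -> Prop) (f : R -> R -> R) :
  cont2 D f -> cont3 (off_axis D) (fun _ z t => f z t).
Proof.
intros f_cont [[r z] t] [_ Dzt].
apply (continuous_comp_2 (fun q : R * R * R => snd (fst q))
  (fun q : R * R * R => snd q) f).
- apply (continuous_comp (fun q : R * R * R => fst q) snd).
  + apply continuous_fst.
  + apply continuous_snd.
- apply continuous_snd.
- exact (f_cont (z, t) Dzt).
Qed.

Lemma cont3_linear (D : R * R -> Prop) (f : R -> R -> R) :
  cont2 D f -> cont3 (off_axis D) (fun r z t => r * f z t).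
Proof.
intros f_cont p Wp.
apply (continuous_mult (fun q : R * R * R => fst (fst q))
  (fun q : R * R * R => f (snd (fst q)) (snd q))).
- apply (continuous_comp (fun q : R * R * R => fst q) fst).
  + apply continuous_fst.
  + apply continuous_fst.
- exact (cont3_radially_constant D f f_cont p Wp).
Qed.

(** Serves the radial derivative of [r * f z t], which is [f z t] and must itself be C1 in the C2
    statement. *)
Lemma C1_rz_radially_constant (D : R * R -> Prop) (f : R -> R -> R) :
  cont2 D f -> has_dz2 D f -> C1_rz (off_axis D) (fun _ z t => f z t).
Proof.
intros f_cont [f_dz f_dz_cont].
repeat split.
- now apply cont3_radially_constant.
- intros r z t _; apply ex_derive_const.
- rewrite dr3_radially_constant.
  intros p _; apply continuous_const.
- intros r z t [_ Dzt]; exact (f_dz z t Dzt).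
- exact (cont3_radially_constant D (dz2 f) f_dz_cont).
Qed.

Lemma C1_rz_linear (D : R * R -> Prop) (f : R -> R -> R) :
  cont2 D f -> has_dz2 D f -> C1_rz (off_axis D) (fun r z t => r * f z t).
Proof.
intros f_cont [f_dz f_dz_cont].
repeat split.
- now apply cont3_linear.
- intros r z t _; auto_derive; easy.
- rewrite dr3_linear.
  now apply cont3_radially_constant.
- intros r z t [_ Dzt]; apply ex_derive_scal; exact (f_dz z t Dzt).
- rewrite dz3_linear.
  now apply cont3_linear.
Qed.

Lemma C1_rzt_linear (D : R * R -> Prop) (f : R -> R -> R) :
  C1_zt D f -> C1_rzt (off_axis D) (fun r z t => r * f z t).
Proof.
intros [f_cont [f_has_dz [f_dt f_dt_cont]]].
split; [now apply C1_rz_linear | split].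
- intros r z t [_ Dzt]; apply ex_derive_scal; exact (f_dt z t Dzt).
- rewrite dt3_linear.
  now apply cont3_linear.
Qed.

Lemma C2_rz_linear (D : R * R -> Prop) (f : R -> R -> R) :
  C2_z D f -> C2_rz (off_axis D) (fun r z t => r * f z t).
Proof.
intros [f_cont [f_has_dz f_has_dzz]].
split; [| split].
- now apply C1_rz_linear.
- rewrite dr3_linear.
  now apply C1_rz_radially_constant.
- rewrite dz3_linear.
  apply C1_rz_linear; [apply f_has_dz | exact f_has_dzz].
Qed.

Theorem theorem1 (nu : R) (D : R * R -> Prop) (u1 omega1 psi1 : R -> R -> R)
    (nu_ge0 : 0 <= nu) (D_open : open D)
    (sol : classical_solution_1D nu D u1 omega1 psi1) :
  classical_solution_axisym_NS nu (off_axis D)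
    (fun r z t => r * u1 z t)
    (fun r z t => r * omega1 z t)
    (fun r z t => r * psi1 z t).
Proof.
destruct sol as [u_C1 omega_C1 u_C2 omega_C2 psi_C2 u_eq omega_eq psi_eq].
split.
- now apply C1_rzt_linear.
- now apply C1_rzt_linear.
- intros nu_gt0; apply C2_rz_linear; auto.
- intros nu_gt0; apply C2_rz_linear; auto.
- now apply C2_rz_linear.
- intros r z t [r_gt0 Dzt]; simpl in r_gt0, Dzt.
  rewrite dt3_linear, v_r_linear, dr3_linear, dz3_linear.
  rewrite v_z_linear, angular_laplacian_linear by easy.
  (* Radial convection, moved to the right, and this term each give [r * dz2 psi1 z t * u1 z t]:
     hence the factor 2 in the equation for [u1]. *)
  replace (1 / r * (r * - dz2 psi1 z t) * (r * u1 z t))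
    with (- (r * dz2 psi1 z t * u1 z t)) by (field; lra).
  generalize (f_equal (Rmult r) (u_eq z t Dzt)); lra.
- intros r z t [r_gt0 Dzt]; simpl in r_gt0, Dzt.
  rewrite dt3_linear, v_r_linear, dr3_linear, dz3_linear, dz3_linear_sqr.
  rewrite v_z_linear, angular_laplacian_linear by easy.
  (* This term equals the radial convection on the left and cancels it, so the equation for [omega1]
     has no such stretching term. *)
  replace (1 / r * (r * - dz2 psi1 z t) * (r * omega1 z t))
    with (r * - dz2 psi1 z t * omega1 z t) by (field; lra).
  replace (1 / r * (r ^ 2 * dz2 (fun z t => u1 z t ^ 2) z t))
    with (r * dz2 (fun z t => u1 z t ^ 2) z t) by (field; lra).
  generalize (f_equal (Rmult r) (omega_eq z t Dzt)); lra.
- intros r z t [r_gt0 Dzt]; simpl in r_gt0, Dzt.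
  rewrite angular_laplacian_linear by easy.
  rewrite <- (psi_eq z t Dzt).
  ring.
- intros r z t [r_gt0 Dzt]; simpl in r_gt0, Dzt.
  (* Only the derivative of [v_r] survives, so the vorticity relation is again [r] times the
     equation for [psi1]. *)
  rewrite dz3_v_r_linear, dr3_v_z_linear by easy.
  rewrite <- (psi_eq z t Dzt).
  ring.
Qed.
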